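(* Let $V=\bigoplus_{n\in\mathbb{Z}}V_n$ be an $\mathcal{H}$-module vertex algebra. Set $L_1^{+}V=\sum_{n\ge 1}L_1^{(n)}V$, a $\mathbb{Z}$-graded subspace of $V$, and let $(L_1^{+}V)_0=L_1^{+}V\cap V_0$ be its degree-zero part. Then the space of all invariant bilinear forms on $V$ (all of which are symmetric) is linearly isomorphic to the dual space $\bigl(V_0/(L_1^{+}V)_0\bigr)^{*}$.
   Context: Throughout, $\mathbb{F}$ is an algebraically closed field of odd prime characteristic $p$, and vertex algebras and their modules are over $\mathbb{F}$ (defined by the usual vacuum, truncation and creation axioms together with the Jacobi identity). Every vertex algebra $V$ is a module for the bialgebra $\mathcal{B}$ with basis $\{\mathcal{D}^{(n)}\}_{n\in\mathbb{N}}$, $\mathcal{D}^{(m)}\mathcal{D}^{(n)}=\binom{m+n}{n}\mathcal{D}^{(m+n)}$, via $\mathcal{D}^{(n)}v=v_{-n-1}\mathbf{1}$. The bialgebra $\mathcal{H}$: let $\mathfrak{sl}_2$ over $\mathbb{C}$ have basis $L_{-1},L_0,L_1$ with $[L_1,L_{-1}]=2L_0$, $[L_0,L_{\pm1}]=\mp L_{\pm1}$; in $U(\mathfrak{sl}_2)$ put $L_{\pm1}^{(n)}=L_{\pm1}^n/n!$ and $L_0^{(n)}=\binom{-2L_0}{n}$; let $U(\mathfrak{sl}_2)_{\mathbb{Z}}$ be the $\mathbb{Z}$-span of all $L_{-1}^{(i)}L_0^{(j)}L_1^{(k)}$ (a subring and Hopf $\mathbb{Z}$-form), and $\mathcal{H}=\mathbb{F}\otimes_{\mathbb{Z}}U(\mathfrak{sl}_2)_{\mathbb{Z}}$,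 a Hopf algebra with $\Delta(L_{\pm1}^{(n)})=\sum_{i}L_{\pm1}^{(n-i)}\otimes L_{\pm1}^{(i)}$, $\Delta(L_0^{(n)})=\sum_i L_0^{(n-i)}\otimes L_0^{(i)}$, $\varepsilon(L_{\pm1}^{(n)})=\varepsilon(L_0^{(n)})=\delta_{n,0}$. Let $\theta$ be the anti-automorphism of $\mathcal{H}$ with $\theta(L_{\pm1}^{(n)})=L_{\mp1}^{(n)}$, $\theta(L_0^{(n)})=L_0^{(n)}$. Write $e^{zL_{\pm1}}=\sum_{n\ge0}z^nL_{\pm1}^{(n)}$. For a $\mathbb{Z}$-graded space and $v$ homogeneous of degree $n$, $f(z)^{\deg}v$ means $f(z)^{n}v$ (extended linearly), e.g. $(1-zz_0)^{-2\deg}v=(1-zz_0)^{-2n}v$, $(-z^{-2})^{\deg}v=(-1)^nz^{-2n}v$. A $\mathbb{Z}$-graded vertex algebra is a vertex algebra $V=\bigoplus_{n\in\mathbb{Z}}V_n$ with $\mathbf{1}\in V_0$ and $u_rV_n\subset V_{m+n-r-1}$ for $u\in V_m$. A $\mathbb{Z}$-graded weight $\mathcal{H}$-module is a $\mathbb{Z}$-graded space $W=\bigoplus W_n$ with an $\mathcal{H}$-action such that $L_{\pm1}^{(r)}W_n\subset W_{n\mp r}$ and $L_0^{(r)}$ acts on $W_n$ as the scalar $\binom{-2n}{r}$. An $\mathcal{H}$-module vertex algebra is a $\mathbb{Z}$-graded vertex algebra $V$ which is also a $\mathbb{Z}$-graded weight $\mathcal{H}$-module with $L_{-1}^{(n)}=\mathcal{D}^{(n)}$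 on $V$ for all $n$, such that (i) $V_n=0$ for $n$ sufficiently negative, (ii) $L_1^{(n)}\mathbf{1}=\delta_{n,0}\mathbf{1}$ for $n\in\mathbb{N}$, and (iii) $e^{zL_1}Y(v,z_0)e^{-zL_1}=Y\bigl(e^{z(1-zz_0)L_1}(1-zz_0)^{-2\deg}v,\,z_0/(1-zz_0)\bigr)$ for all $v\in V$. A bilinear form $(\cdot,\cdot)$ on $V$ is invariant if $(Y(v,z)w,w')=(w,Y(e^{zL_1}(-z^{-2})^{\deg}v,z^{-1})w')$ for all $v,w,w'\in V$, and $(aw,w')=(w,\theta(a)w')$ for all $a\in\mathcal{H}$, $w,w'\in V$. *)

(* Defs.v *)
From HB Require Import structures.
From mathcomp Require Import all_boot all_order all_algebra.
Set Implicit Arguments. Unset Strict Implicit. Unset Printing Implicit Defensive.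
Import GRing.Theory.
Local Open Scope ring_scope.

(* Generalized binomial coefficient binom(e, j) for e an integer, as an
   element of a ring: e(e-1)...(e-j+1)/j!  (an integer, mapped into R).
   For e = Negz m = -(m+1):  binom(-(m+1), j) = (-1)^j binom(m+j, j). *)
Definition zbinom (R : pzRingType) (e : int) (j : nat) : R :=
  match e with
  | Posz m => ('C(m, j))%:R
  | Negz m => (-1) ^+ j * ('C(m + j, j))%:R
  end.

Definition intsign (R : pzRingType) (d : int) : R := (-1) ^+ `|d|%N.

Section Defs.
Variables (F : fieldType) (V : lmodType F).

(* ---------- vertex algebras: Y n u v = u_n v ---------- *)
Variable Y : int -> V -> V -> V.
Variable one : V.

Definition va_bilinear :=
  forall n : int,
    (forall a u u' v, Y n (a *: u + u') v = a *: Y n u v + Y n u' v) /\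
    (forall a u v v', Y n u (a *: v + v') = a *: Y n u v + Y n u v').

Definition va_truncation :=
  forall u v, exists N : int, forall n : int, N <= n -> Y n u v = 0.

Definition va_vacuum :=
  forall (v : V) (n : int), Y n one v = if n == -1 then v else 0.

Definition va_creation :=
  forall u, Y (-1) u one = u /\
            forall n : int, 0 <= n -> Y n u one = 0.

(* Jacobi identity, in components (Borcherds identity); the infinite sums
   over i are finite, and are computed up to any N beyond which all
   relevant terms vanish. *)
Definition va_jacobi :=
  forall (u v w : V) (m n l : int) (N : nat),
    (forall i : nat, (N <= i)%N ->
       [/\ Y (l + i%:Z) u v = 0, Y (n + i%:Z) v w = 0 & Y (m + i%:Z) u w = 0]) ->
    \sum_(i < N) zbinom F m i *: Y (m + n - (i : nat)%:Z) (Y (l + (i : nat)%:Z) u v) w =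
    \sum_(i < N) ((-1) ^+ i * zbinom F l i) *:
        (Y (m + l - (i : nat)%:Z) u (Y (n + (i : nat)%:Z) v w)
         - intsign F l *: Y (n + l - (i : nat)%:Z) v (Y (m + (i : nat)%:Z) u w)).

Definition vertex_algebra :=
  [/\ va_bilinear, va_truncation, va_vacuum, va_creation & va_jacobi].

Variable Vg : int -> V -> Prop.

Definition is_grading :=
  [/\ (forall n, Vg n 0),
      (forall n a x y, Vg n x -> Vg n y -> Vg n (a *: x + y)),
      (forall v, exists (s : seq int) (f : int -> V),
          [/\ uniq s, (forall n, Vg n (f n)) & v = \sum_(n <- s) f n]) &
      (forall (s : seq int) (f : int -> V), uniq s -> (forall n, Vg n (f n)) ->
          \sum_(n <- s) f n = 0 -> forall n, n \in s -> f n = 0)].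

Definition graded_VA :=
  [/\ vertex_algebra, is_grading, Vg 0 one &
      forall (m n r : int) u v, Vg m u -> Vg n v -> Vg (m + n - r - 1) (Y r u v)].

Variables L1 Lm1 L0 : nat -> V -> V.

Definition lin_op (f : V -> V) := forall a x y, f (a *: x + y) = a *: f x + f y.

Definition weight_H_module :=
  [/\ (forall r, [/\ lin_op (L1 r), lin_op (Lm1 r) & lin_op (L0 r)]),
      (forall v, L1 0 v = v /\ Lm1 0 v = v),
      (forall m n v, L1 m (L1 n v) = ('C(m + n, n))%:R *: L1 (m + n) v /\
                     Lm1 m (Lm1 n v) = ('C(m + n, n))%:R *: Lm1 (m + n) v),
      (forall (n : int) r v, Vg n v ->
          [/\ L0 r v = zbinom F (- 2 * n) r *: v,
              Vg (n - r%:Z) (L1 r v) & Vg (n + r%:Z) (Lm1 r v)]) &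
      (* Kostant commutation relation in the hyperalgebra, evaluated on V_n *)
      (forall (n : int) (a b : nat) w, Vg n w ->
          L1 a (Lm1 b w) =
          \sum_(j < (minn a b).+1)
             ((-1) ^+ j * zbinom F (- 2 * n + a%:Z - b%:Z) j) *:
                Lm1 (b - j) (L1 (a - j) w))].

(* condition (iii), in components: coefficient of z^a z0^(-n-1) applied to w,
   for v homogeneous of degree d *)
Definition cond_iii :=
  forall (d : int) v w (a : nat) (n : int), Vg d v ->
    \sum_(r < a.+1) (-1) ^+ (a - r) *: L1 r (Y n v (L1 (a - r) w)) =
    \sum_(j < a.+1) ((-1) ^+ j * zbinom F (a%:Z - 2 * d + n + 1) j) *:
        Y (n + (j : nat)%:Z) (L1 (a - j) v) w.

Definition H_module_VA :=
  [/\ graded_VA, weight_H_module,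
      (forall (n : nat) v, Lm1 n v = Y (- n%:Z - 1) v one),
      (exists n0 : int, forall n v, n < n0 -> Vg n v -> v = 0) &
      [/\ (forall n, L1 n one = if n == 0%N then one else 0) & cond_iii]].

Definition bilinear_form (B : V -> V -> F) :=
  (forall a x y z, B (a *: x + y) z = a * B x z + B y z) /\
  (forall a x y z, B x (a *: y + z) = a * B x y + B x z).

(* (Y(v,z)w,w') = (w, Y(e^{zL1}(-z^{-2})^{deg} v, z^{-1}) w'), coefficient of
   z^{-n-1}, for v homogeneous of degree d; the sum over k is finite. *)
Definition invariant_Y (B : V -> V -> F) :=
  forall (d : int) v w w' (n : int) (N : nat), Vg d v ->
    (forall k, (N <= k)%N -> L1 k v = 0) ->
    B (Y n v w) w' =
    intsign F d * \sum_(k < N) B w (Y (2 * d - (k : nat)%:Z - n - 2) (L1 k v) w').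

(* (a w, w') = (w, theta(a) w') for the generators a of H *)
Definition invariant_H (B : V -> V -> F) :=
  forall r w w', [/\ B (L1 r w) w' = B w (Lm1 r w'),
                     B (Lm1 r w) w' = B w (L1 r w') &
                     B (L0 r w) w' = B w (L0 r w')].

Definition invariant_form (B : V -> V -> F) :=
  [/\ bilinear_form B, invariant_Y B & invariant_H B].

Definition L1plus (x : V) :=
  exists (N : nat) (y : nat -> V), x = \sum_(1 <= n < N) L1 n (y n).

(* linear functionals on V_0 (extended by 0 on the other V_n) vanishing on
   (L_1^+ V)_0 = L_1^+ V \cap V_0 *)
Definition dual_quotient_elt (f : V -> F) :=
  [/\ (forall a x y, f (a *: x + y) = a * f x + f y),
      (forall (n : int) x, n != 0 -> Vg n x -> f x = 0) &
      (forall x, Vg 0 x -> L1plus x -> f x = 0)].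

End Defs.

(* Main.v *)
Require Import Defs.
From HB Require Import structures.
From mathcomp Require Import all_boot all_order all_algebra.
From mathcomp Require Import zify.
From Stdlib Require Import ClassicalEpsilon.
Import GRing.Theory.
Local Open Scope ring_scope.

(** An invariant form B is determined by f = B(1, -): invariance of Y applied to
    u = u_{-1} 1 gives, for u in V_d,
      B(u, v) = (-1)^d \sum_k f((L_1^(k) u)_{2d-k-1} v),
    and H-invariance makes f vanish on L_1^+ V and on V_n for n <> 0.
    Conversely, such an f automatically kills L_{-1}^(b) V for b >= 1, so that
    skew-symmetry reads f(u_n v) = (-1)^{n+1} f(v_n u). Combined with the
    conjugation formula (iii) it turns \sum_l f((L_1^(l) w)_{2e-l-1-i} x), for w in
    V_e, into the sum with w and x exchanged times \sum_j (-1)^j binom(i, j), which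
    vanishes for i > 0. The case i = 0 is the symmetry of B; the case i > 0 removes
    all terms but one of the Jacobi identity, which yields the invariance. *)

(** * Reindexing of finite sums *)

Section FiniteSums.
Variable V : nmodType.

Lemma sum_ord_widen (N M : nat) (F : nat -> V) :
  (N <= M)%N -> (forall i, (N <= i)%N -> F i = 0) ->
  \sum_(i < M) F i = \sum_(i < N) F i.
Proof.
move=> NM F0; rewrite (big_ord_widen M F NM) [RHS]big_mkcond /=.
by apply: eq_bigr => i _; case: ltnP => // /F0.
Qed.

(** Substitute [l = j + k]: the rectangle supporting [g] lies inside the triangle [j + k < M]. This
    turns the coefficients of products of exponential series into independent sums. *)
Lemma sum_triangle (M J K : nat) (g : nat -> nat -> V) :
  (J + K <= M)%N -> (forall j k, (J <= j)%N || (K <= k)%N -> g j k = 0) ->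
  \sum_(l < M) \sum_(j < l.+1) g j (l - j)%N = \sum_(k < K) \sum_(j < J) g j k.
Proof.
move=> JKM g0.
have -> : \sum_(l < M) \sum_(j < l.+1) g j (l - j)%N
        = \sum_(j < M) \sum_(l < M | (j <= l)%N) g j (l - j)%N.
  rewrite [RHS](exchange_big_dep xpredT) //=; apply: eq_bigr => l _.
  by rewrite (big_ord_widen M (fun j => g j (l - j)%N) (ltn_ord l)).
rewrite [RHS]exchange_big /= (sum_ord_widen J M (fun j => \sum_(l < M | (j <= l)%N) g j (l - j)%N)).
- apply: eq_bigr => j _; rewrite -(sum_ord_widen K (M - j)); first last.
  + by move=> k Kk; rewrite g0 // Kk orbT.
  + have := ltn_ord j; lia.
  rewrite -(big_mkord xpredT (fun k => g j k)) -{1}(addKn j (M - j)%N) subnKC;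
    last by have := ltn_ord j; lia.
  rewrite -[in RHS](subnn j) -(big_mkord (fun l => (j <= l)%N) (fun l => g j (l - j)%N)).
  rewrite (big_cat_nat (n := j)) /=; [|done|have := ltn_ord j; lia].
  rewrite big_nat_cond big_pred0 ?add0r; last by move=> l; lia.
  rewrite -{1}[X in \sum_(X <= _ < _ | _) _]add0n big_addn [LHS]big_mkcond /= subnn.
  by apply: eq_bigr => l _; rewrite leq_addl addnK.
- by lia.
- by move=> j Jj; rewrite big1 // => l _; rewrite g0 // Jj.
Qed.

End FiniteSums.

(** * Binomial coefficients with integer upper entry, and signs *)

Section Binomials.
Variable R : comPzRingType.
Implicit Types (x y : int) (i j m r : nat).

Lemma zbinom0 x : zbinom R x 0 = 1.
Proof. by case: x => m; rewrite /= ?expr0 ?mul1r bin0. Qed.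

Lemma zbinom_pascal x j :
  zbinom R (x + 1) j.+1 = zbinom R x j.+1 + zbinom R x j.
Proof.
case: x => m.
  have -> : m%:Z + 1 = m.+1%:Z by lia.
  by rewrite /= binS natrD.
case: m => [|m].
  have -> : Negz 0 + 1 = 0 by lia.
  by rewrite /= bin0n !add0n !binn exprS /= !mulr1 mulN1r addNr.
have -> : Negz m.+1 + 1 = Negz m by lia.
rewrite /= addSn binS natrD [(m.+1 + j)%N]addSnnS exprS !mulN1r mulrDr.
by rewrite !mulNr addrNK.
Qed.

Lemma zbinom_Vandermonde m y r :
  zbinom R (m%:Z + y) r = \sum_(i < r.+1) zbinom R m i * zbinom R y (r - i).
Proof.
elim: m r => [|m IH] r.
  rewrite add0r big_ord_recl /= bin0 mul1r subn0 big1 ?addr0 // => i _.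
  by rewrite bin0n /= mul0r.
have -> : m.+1%:Z + y = m%:Z + y + 1 by lia.
case: r => [|r]; first by rewrite big_ord_recl big_ord0 !zbinom0 mul1r addr0.
rewrite zbinom_pascal !IH big_ord_recl [RHS]big_ord_recl !zbinom0 -addrA; congr (_ + _).
rewrite -big_split; apply: eq_bigr => i _ /=.
by rewrite /bump /= add1n subSS binS natrD mulrDl.
Qed.

(** Absorbs the signs of condition (iii), so that its coefficients become those on the left of the
    Jacobi identity. *)
Lemma zbinom_upper_negation x j :
  (-1) ^+ j * zbinom R x j = zbinom R (j%:Z - 1 - x) j.
Proof.
case: x => m.
  case: (ltnP m j) => mj.
    have -> : j%:Z - 1 - m%:Z = (j - 1 - m)%N%:Z by lia.
    by rewrite /= !bin_small ?mulr0 //; lia.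
  have -> : j%:Z - 1 - m%:Z = Negz (m - j) by lia.
  by rewrite /= subnK.
have -> : j%:Z - 1 - Negz m = (m + j)%N%:Z by lia.
by rewrite /= mulrA -exprMn mulrN1 opprK expr1n mul1r.
Qed.

Lemma sum_sign_bin m : \sum_(j < m.+1) (-1) ^+ j * 'C(m, j)%:R = (m == 0%N)%:R :> R.
Proof.
have := exprDn (1 : R) (-1) m; rewrite subrr expr0n => ->.
by apply: eq_bigr => j _; rewrite expr1n mul1r mulr_natr.
Qed.

(** Lets the operators [L0 r] with [r > 0] separate degree zero from every other degree, even those
    divisible by the characteristic. *)
Lemma zbinom_nontrivial (Rnt : (1 : R) != 0) x :
  x != 0 -> exists2 r, (0 < r)%N & zbinom R x r != 0.
Proof.
case: x => m x0; first by exists m; [lia | rewrite /= binn].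
have [/existsP[r /andP[]]|/existsPn H] :=
    boolP [exists r : 'I_m.+2, (0 < r)%N && (zbinom R (Negz m) r != 0)].
  by exists r.
(* If all the coefficients of [-(m+1)] in orders [1] to [m+1] vanished, the convolution for
   [(m+1) + (-(m+1)) = 0] in order [m+1] would reduce to [0 = 1]. *)
have := zbinom_Vandermonde m.+1 (Negz m) m.+1.
have -> : m.+1%:Z + Negz m = 0 by lia.
rewrite big_ord_recr big1 /=; last first.
  move=> i _; have im : (m.+1 - i < m.+2)%N by lia.
  have := H (Ordinal im); rewrite /= subn_gt0 (ltn_ord i) /= negbK => /eqP ->.
  by rewrite mulr0.
by rewrite subnn bin0n binn !bin0 add0r !mulr1 => /esym/eqP; rewrite (negbTE Rnt).
Qed.

Lemma intsignD x y : intsign R (x + y) = intsign R x * intsign R y.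
Proof.
rewrite /intsign -exprD -signr_odd -[RHS]signr_odd; congr (_ ^+ _).
by congr nat_of_bool; lia.
Qed.

Lemma intsignN x : intsign R (- x) = intsign R x.
Proof. by rewrite /intsign abszN. Qed.

Lemma intsign_sqr x : intsign R x * intsign R x = 1.
Proof. by rewrite /intsign -exprMn mulrN1 opprK expr1n. Qed.

End Binomials.

Set Implicit Arguments.
Unset Strict Implicit.

(** * Linearity for functions not bundled as linear maps *)

Section LinearMaps.
Variables (R : pzRingType) (U W : lmodType R) (f : U -> W).
Hypothesis f_lin : linear f.
Let g : {linear U -> W} := HB.pack f (GRing.isLinear.Build R U W *:%R f f_lin).

Lemma lin_0 : f 0 = 0. Proof. exact: (linear0 g). Qed.
Lemma lin_D x y : f (x + y) = f x + f y. Proof. exact: (linearD g). Qed.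
Lemma lin_B x y : f (x - y) = f x - f y. Proof. exact: (linearB g). Qed.
Lemma lin_Z a x : f (a *: x) = a *: f x. Proof. exact: (linearZ_LR g). Qed.
Lemma lin_sum (I : Type) (r : seq I) (P : pred I) (E : I -> U) :
  f (\sum_(i <- r | P i) E i) = \sum_(i <- r | P i) f (E i).
Proof. exact: (linear_sum g). Qed.

End LinearMaps.

(** * The axioms in usable form, and reduction to homogeneous vectors *)

Section ModuleVertexAlgebra.
Variables (F : fieldType) (V : lmodType F).
Variables (Y : int -> V -> V -> V) (one : V) (Vg : int -> V -> Prop).
Variables (L1 Lm1 L0 : nat -> V -> V).
Hypothesis HV : H_module_VA Y one Vg L1 Lm1 L0.

Lemma va_axioms : vertex_algebra Y one.
Proof. by case: HV => -[]. Qed.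

Lemma Y_linl n v : linear (Y n ^~ v).
Proof. by case: va_axioms => /(_ n)[+ _] _ _ _ _ a u u'; apply. Qed.

Lemma Y_linr n u : linear (Y n u).
Proof. by case: va_axioms => /(_ n)[_ +] _ _ _ _ a v v'; apply. Qed.

Lemma Y_jacobi : va_jacobi Y.
Proof. by case: va_axioms. Qed.

Lemma Y_trunc u v : exists N : int, forall n : int, N <= n -> Y n u v = 0.
Proof. by case: va_axioms => _ /(_ u v). Qed.

Lemma Y_vacuum v n : Y n one v = if n == -1 then v else 0.
Proof. by case: va_axioms => _ _ /(_ v n). Qed.

Lemma Y_creation u (n : int) : 0 <= n -> Y n u one = 0.
Proof. by case: va_axioms => _ _ _ /(_ u)[_ +] _; apply. Qed.

Lemma grading_axioms : is_grading Vg.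
Proof. by case: HV => -[]. Qed.

Lemma homog_one : Vg 0 one.
Proof. by case: HV => -[]. Qed.

Lemma homog_Y m n r u v : Vg m u -> Vg n v -> Vg (m + n - r - 1) (Y r u v).
Proof. by case: HV => -[_ _ _ +] _ _ _ _; apply. Qed.

Lemma homog_0 n : Vg n 0.
Proof. by case: grading_axioms. Qed.

Lemma weight_axioms : weight_H_module Vg L1 Lm1 L0.
Proof. by case: HV. Qed.

Lemma L1_lin r : linear (L1 r).
Proof. by case: weight_axioms => /(_ r)[+ _ _] _ _ _ _ a x y; apply. Qed.

Lemma Lm1_lin r : linear (Lm1 r).
Proof. by case: weight_axioms => /(_ r)[_ + _] _ _ _ _ a x y; apply. Qed.

Lemma L0_lin r : linear (L0 r).
Proof. by case: weight_axioms => /(_ r)[_ _ +] _ _ _ _ a x y; apply. Qed.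

Lemma L1_0 v : L1 0 v = v.
Proof. by case: weight_axioms => _ /(_ v)[]. Qed.

Lemma Lm1_0 v : Lm1 0 v = v.
Proof. by case: weight_axioms => _ /(_ v)[]. Qed.

Lemma L1_L1 m n v : L1 m (L1 n v) = 'C(m + n, n)%:R *: L1 (m + n) v.
Proof. by case: weight_axioms => _ _ /(_ m n v)[]. Qed.

Lemma homog_L1 n r v : Vg n v -> Vg (n - r%:Z) (L1 r v).
Proof. by move=> nv; case: weight_axioms => _ _ _ /(_ n r v nv)[]. Qed.

Lemma homog_Lm1 n r v : Vg n v -> Vg (n + r%:Z) (Lm1 r v).
Proof. by move=> nv; case: weight_axioms => _ _ _ /(_ n r v nv)[]. Qed.

Lemma L0_homog n r v : Vg n v -> L0 r v = zbinom F (- 2 * n) r *: v.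
Proof. by move=> nv; case: weight_axioms => _ _ _ /(_ n r v nv)[]. Qed.

Lemma L1_Lm1 n a b w : Vg n w -> L1 a (Lm1 b w) =
  \sum_(j < (minn a b).+1) ((-1) ^+ j * zbinom F (- 2 * n + a%:Z - b%:Z) j) *:
     Lm1 (b - j) (L1 (a - j) w).
Proof. by case: weight_axioms => _ _ _ _; apply. Qed.

Lemma Lm1_Y n v : Lm1 n v = Y (- n%:Z - 1) v one.
Proof. by case: HV. Qed.

Lemma L1_one n : L1 n one = if n == 0%N then one else 0.
Proof. by case: HV => _ _ _ _ []. Qed.

Lemma Y_cond_iii : cond_iii Y Vg L1.
Proof. by case: HV => _ _ _ _ []. Qed.

Lemma degree_bound : exists n0 : int, forall n v, n < n0 -> Vg n v -> v = 0.
Proof. by case: HV. Qed.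

Lemma homog_L1_trunc d : exists N, forall u, Vg d u -> forall k, (N <= k)%N -> L1 k u = 0.
Proof.
have [n0 n0P] := degree_bound; exists (`|d - n0|%N.+1) => u du k Nk.
by apply: (n0P (d - k%:Z)); [lia | exact: homog_L1].
Qed.

Lemma homog_ind (P : V -> Prop) :
  (forall a x y, P x -> P y -> P (a *: x + y)) ->
  (forall d x, Vg d x -> P x) -> forall x, P x.
Proof.
move=> PD Ph x; have [_ _ /(_ x)[s [g [_ gP ->]]] _] := grading_axioms.
elim: s => [|d s IH]; first by rewrite big_nil; apply: Ph (homog_0 0).
by rewrite big_cons -[g d]scale1r; apply: PD => //; apply: Ph (gP d).
Qed.

(** * Identities for a functional vanishing on the image of [L1] and off degree zero *)

Section Functional.
Variable f : V -> F.
Hypothesis Hf : dual_quotient_elt Vg L1 f.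

Lemma fun_lin : linear (f : V -> F^o).
Proof. by case: Hf. Qed.

Lemma fun_0 : f 0 = 0.
Proof. exact: (lin_0 fun_lin). Qed.

Lemma fun_D x y : f (x + y) = f x + f y.
Proof. exact: (lin_D fun_lin). Qed.

Lemma fun_B x y : f (x - y) = f x - f y.
Proof. exact: (lin_B fun_lin). Qed.

Lemma fun_Z a x : f (a *: x) = a * f x.
Proof. exact: (lin_Z fun_lin). Qed.

Lemma fun_sum (I : Type) (r : seq I) (P : pred I) (E : I -> V) :
  f (\sum_(i <- r | P i) E i) = \sum_(i <- r | P i) f (E i).
Proof. exact: (lin_sum fun_lin). Qed.

Lemma fun_degree n x : n != 0 -> Vg n x -> f x = 0.
Proof. by case: Hf => _ + _; apply. Qed.

(** The hypothesis on [f] concerns only vectors of degree zero. By linearity [y] may be taken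
    homogeneous; degree [r] falls under that hypothesis, and in any other degree [L1 r y] is killed
    for lying off degree zero. *)
Lemma fun_L1 r y : (0 < r)%N -> f (L1 r y) = 0.
Proof.
move=> r0; move: y; apply: homog_ind => [a x y fx fy|d y dy].
  by rewrite L1_lin fun_D fun_Z fx fy mulr0 addr0.
have [dr|/eqP dr] := eqVneq d r%:Z; last first.
  by apply: fun_degree (homog_L1 r dy); lia.
have [_ _ fL] := Hf; apply: fL.
  by have := homog_L1 r dy; rewrite dr subrr.
exists r.+1, (fun n => if n == r then y else 0).
rewrite big_nat_recr //= eqxx big_nat_cond big1 ?add0r // => n.
by case: eqP => [->|_]; [rewrite ltnn !andbF | rewrite (lin_0 (L1_lin n))].
Qed.

(** Since [f] kills [L1 b (Lm1 (2 * b) w)] for [w] of degree [-b], and the Kostant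
    relation rewrites this vector as [+- Lm1 b w] plus terms [Lm1 c w'] with
    [c > b], one concludes by descending induction on the degree of [w]. *)
Lemma fun_Lm1 b w : (0 < b)%N -> f (Lm1 b w) = 0.
Proof.
have [n0 n0P] := degree_bound.
(* [k] bounds how far [b] still is from [|n0| + 1], from where on [-b] lies below every degree that
   occurs. *)
have main k : forall b w, (0 < b)%N -> (`|n0|%N.+1 <= b + k)%N -> Vg (- b%:Z) w ->
    f (Lm1 b w) = 0.
  elim: k => [|k IH] {}b {}w b0 bk bw.
    have -> : w = 0 by apply: n0P bw; lia.
    by rewrite (lin_0 (Lm1_lin b)) fun_0.
  have := fun_L1 (Lm1 (b + b) w) b0.
  rewrite (L1_Lm1 _ _ bw) fun_sum (minn_idPl (leq_addr _ _)) big_ord_recr /= big1.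
    rewrite add0r fun_Z subnn addnK L1_0.
    (* In degree [-b] the last Kostant coefficient is [binom(b, b) = 1] up to sign, hence invertible
       in any characteristic. *)
    have -> : - 2 * - b%:Z + b%:Z - (b + b)%N%:Z = b%:Z by lia.
    rewrite /= binn mulr1 => /eqP; rewrite mulf_eq0 signr_eq0 /=.
    by move=> /eqP.
  move=> j _; have jb := ltn_ord j.
  rewrite fun_Z IH ?mulr0 //; [lia|lia|].
  have -> : - (b + b - j)%N%:Z = - b%:Z - (b - j)%N%:Z by lia.
  exact: homog_L1.
move=> b0; move: w; apply: homog_ind => [a x y fx fy|d y dy].
  by rewrite Lm1_lin fun_D fun_Z fx fy mulr0 addr0.
have [db|/eqP db] := eqVneq d (- b%:Z); last first.
  by apply: fun_degree (homog_Lm1 b dy); lia.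
by apply: (main `|n0|%N.+1); rewrite -?db //; lia.
Qed.

(** Jacobi identity applied to [one] with exponents [-1], [0] and [n]. The left side is a
    combination of the [Lm1 i (Y (n + i) u v)], of which [f] sees only [i = 0]; on the right the
    creation axiom leaves only [Y n v u]. *)
Lemma fun_skew n u v : f (Y n u v) = - (intsign F n * f (Y n v u)).
Proof.
have [N1 N1P] := Y_trunc u v.
pose N := `|N1 - n|%N.+1.
have trunc i : (N.+1 <= i)%N ->
    [/\ Y (n + i%:Z) u v = 0, Y (0 + i%:Z) v one = 0 & Y (-1 + i%:Z) u one = 0].
  by move=> Ni; split; [apply: N1P | apply: Y_creation | apply: Y_creation]; lia.
have /(congr1 f) := Y_jacobi trunc.
rewrite !fun_sum big_ord_recl zbinom0 scale1r big1 => [|i _]; last first.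
  have -> : -1 + 0 - (bump 0 i)%N%:Z = - (bump 0 i)%N%:Z - 1 :> int by lia.
  by rewrite fun_Z -Lm1_Y fun_Lm1 ?mulr0.
rewrite addr0 big_ord_recl big1 => [|i _]; last first.
  rewrite [Y (0 + _) v one]Y_creation ?[Y (-1 + _) u one]Y_creation; try by rewrite /= /bump; lia.
  by rewrite !(lin_0 (Y_linr _ _)) scaler0 subrr scaler0 fun_0.
have -> : -1 + 0 - (0%N)%:Z = - (0%N)%:Z - 1 :> int by lia.
rewrite -Lm1_Y Lm1_0 addr0 zbinom0 mulr1 scale1r addr0 (Y_creation v) //.
rewrite (lin_0 (Y_linr _ _)) sub0r -Lm1_Y Lm1_0 => ->.
have -> : 0 + n - (0%N)%:Z = n by lia.
by rewrite -scaleNr fun_Z mulNr.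
Qed.

(** On the left of condition (iii), [f] kills every term beginning with [L1 r], [r > 0]. The
    surviving term lets [L1 a] be moved from the second factor to the first. *)
Lemma fun_cond_iii d v w a n : Vg d v ->
  (-1) ^+ a * f (Y n v (L1 a w)) =
  \sum_(j < a.+1) (-1) ^+ j * zbinom F (a%:Z - 2 * d + n + 1) j *
     f (Y (n + (j : nat)%:Z) (L1 (a - j) v) w).
Proof.
move=> dv; have /(congr1 f) := Y_cond_iii w a n dv.
rewrite !fun_sum big_ord_recl big1 => [|r _]; last by rewrite fun_Z fun_L1 ?mulr0.
rewrite addr0 fun_Z subn0 L1_0 => ->.
by apply: eq_bigr => j _; rewrite fun_Z.
Qed.

(** Skew-symmetry brings [x] to the front and [fun_cond_iii] moves [L1 l] onto it. With [k = l - j]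
    the double sum then splits, and its sum over [j] is the expansion of [(1 - 1)^i]. *)
Lemma pairing_swap e i w x N M : Vg e w -> Vg (e - i%:Z) x ->
  (forall l, (N <= l)%N -> L1 l w = 0) -> (forall k, (M <= k)%N -> L1 k x = 0) ->
  \sum_(l < N) f (Y (2 * e - (l : nat)%:Z - 1 - i%:Z) (L1 l w) x) =
  (i == 0%N)%:R * \sum_(k < M) f (Y (2 * e - (k : nat)%:Z - 1) (L1 k x) w).
Proof.
move=> ew ex wN xM.
pose g j k := (-1) ^+ j * 'C(i, j)%:R *
  f (Y (2 * e - i%:Z - 1 - k%:Z) (L1 k x) w).
pose P := (i.+1 + M + N)%N.
transitivity ((-1) ^+ i * \sum_(l < P) \sum_(j < l.+1) g j (l - j)%N).
  pose h l := f (Y (2 * e - l%:Z - 1 - i%:Z) (L1 l w) x).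
  have h0 l : (N <= l)%N -> h l = 0.
    by move=> Nl; rewrite /h wN // (lin_0 (Y_linl _ _)) fun_0.
  rewrite -(sum_ord_widen _ N P h _ h0) ?leq_addl // mulr_sumr.
  apply: eq_bigr => l _; rewrite /h fun_skew.
  have := fun_cond_iii w l (2 * e - l%:Z - 1 - i%:Z) ex.
  (* The upper entry of the binomial loses its dependence on [l]; this is what makes the term a
     function of [j] and [l - j] alone. *)
  have -> : l%:Z - 2 * (e - i%:Z) + (2 * e - l%:Z - 1 - i%:Z) + 1 = i%:Z by lia.
  move=> E; transitivity ((-1) ^+ i * ((-1) ^+ l * f (Y (2 * e - l%:Z - 1 - i%:Z) x (L1 l w)))).
    rewrite mulrA -mulNr; congr (_ * _).
    have -> : 2 * e - l%:Z - 1 - i%:Z = (e + e) + (- 1 + (- l%:Z + - i%:Z)) by lia.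
    by rewrite !intsignD intsign_sqr mul1r !intsignN /intsign /= mulN1r opprK mulrC.
  rewrite E; congr (_ * _); apply: eq_bigr => j _; rewrite /g; congr (_ * f (Y _ _ _)).
  by have := ltn_ord j; lia.
rewrite (sum_triangle _ P i.+1 M) ?leq_addr //; last first.
  move=> j k /orP[ij|Mk]; rewrite /g; first by rewrite bin_small // mulr0 mul0r.
  by rewrite xM // (lin_0 (Y_linl _ _)) fun_0 mulr0.
rewrite !mulr_sumr; apply: eq_bigr => k _.
rewrite -mulr_suml sum_sign_bin mulrA; case: i {ew ex g P} => [|i] /=.
  by rewrite mul1r; congr (_ * f (Y _ _ _)); lia.
by rewrite mulr0 !mul0r.
Qed.

(** By degree only the component of [x] in degree [e - i] contributes, and for it [pairing_swap] has
    the factor [0]. *)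
Lemma pairing_neg_degree e i w x N : (0 < i)%N -> Vg e w ->
  (forall l, (N <= l)%N -> L1 l w = 0) ->
  \sum_(l < N) f (Y (2 * e - (l : nat)%:Z - 1 - i%:Z) (L1 l w) x) = 0.
Proof.
move=> i0 ew wN; move: x; apply: homog_ind => [a x y IHx IHy|d x dx].
  under eq_bigr => l _ do rewrite Y_linr fun_D fun_Z.
  by rewrite big_split -mulr_sumr /= IHx IHy mulr0 addr0.
have [dei|/eqP dei] := eqVneq d (e - i%:Z).
  rewrite dei in dx; have [M MP] := homog_L1_trunc (e - i%:Z).
  by rewrite (pairing_swap ew dx wN (MP _ dx)) gtn_eqF // mul0r.
apply: big1 => l _; apply: fun_degree (homog_Y _ (homog_L1 _ ew) dx); lia.
Qed.
End Functional.

(** Condition (iii) multiplied on the right by [e^{z L_1}]. *)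
Lemma L1_Y d v w r n : Vg d v ->
  L1 r (Y n v w) = \sum_(s < r.+1) \sum_(j < s.+1)
    ((-1) ^+ j * zbinom F ((s : nat)%:Z - 2 * d + n + 1) j) *:
      Y (n + (j : nat)%:Z) (L1 (s - j) v) (L1 (r - s) w).
Proof.
move=> dv.
(* [G q t] is the term of [e^{zL_1} Y(v) e^{-zL_1} e^{zL_1}] of order [q] in the first factor and
   [t] in the inverse one, the two exponentials on the right being merged by [L1_L1]. Summed over
   [t] it leaves only [q = r]; grouped by [s = q + t] it is condition (iii). *)
pose G q t := if (q <= r)%N
  then ((-1) ^+ t * 'C(r - q, t)%:R) *: L1 q (Y n v (L1 (r - q) w)) else 0.
transitivity (\sum_(s < r.+1 + r.+1) \sum_(q < s.+1) G q (s - q)%N).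
  rewrite (sum_triangle _ _ r.+1 r.+1 G) //; last first.
    move=> q t; rewrite /G; case: (leqP q r) => //= qr rt.
    have qt : (r - q < t)%N by lia.
    by rewrite bin_small ?mulr0 ?scale0r.
  rewrite exchange_big big_ord_recr big1 /= => [|q _].
    rewrite add0r big_ord_recl big1 => [|t _];
      last by rewrite /G leqnn subnn bin_small // mulr0 scale0r.
    by rewrite /G leqnn subnn bin0 mulr1 expr0 scale1r L1_0 addr0.
  have qr := ltn_ord q; rewrite /G ltnW // -scaler_suml.
  rewrite (sum_ord_widen _ (r - q).+1 r.+1 (fun t => (-1) ^+ t * 'C(r - q, t)%:R)).
  - by rewrite sum_sign_bin subn_eq0 leqNgt qr scale0r.
  - by rewrite ltnS leq_subr.
  - by move=> t rt; rewrite bin_small ?mulr0.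
rewrite (sum_ord_widen _ r.+1 _ (fun s => \sum_(q < s.+1) G q (s - q)%N)); last first.
- move=> s rs; apply: big1 => q _; rewrite /G; case: leqP => // qr.
  by rewrite bin_small ?mulr0 ?scale0r //; lia.
- by rewrite leq_addr.
apply: eq_bigr => s _; rewrite -Y_cond_iii //; apply: eq_bigr => q _.
have := ltn_ord q; have := ltn_ord s; rewrite !ltnS => sr qs.
rewrite /G (leq_trans qs sr) L1_L1.
have -> : (s - q + (r - s) = r - q)%N by lia.
rewrite (lin_Z (Y_linr _ _)) (lin_Z (L1_lin _)) scalerA -bin_sub; last by lia.
by congr ((_ * 'C(_, _)%:R) *: _); lia.
Qed.
End ModuleVertexAlgebra.

(** * A common truncation order and a binomial identity *)

Lemma uniform_bound (P : nat -> nat -> Prop) :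
  (forall k, exists J, forall j, (J <= j)%N -> P k j) ->
  forall K, exists J, forall k j, (k < K)%N -> (J <= j)%N -> P k j.
Proof.
move=> HP; elim=> [|K [J JP]]; first by exists 0%N.
have [J' J'P] := HP K; exists (J + J')%N => k j; rewrite ltnS leq_eqVlt => /orP[/eqP->|kK] Jj.
  by apply: J'P; lia.
by apply: JP => //; lia.
Qed.

(** Since [(-1)^(r-s) C(q + r - s, r - s) = binom(-(q+1), r - s)], this is [(-1)^r] times the
    Vandermonde convolution for [q + (-(q+1)) = -1], and [binom(-1, r) = (-1)^r]. *)
Lemma sum_bin_sign_bin (R : comPzRingType) (q r : nat) :
  \sum_(s < q.+1) (if (s <= r)%N then (-1) ^+ s * 'C(q + (r - s), r - s)%:R * 'C(q, s)%:R
                   else 0) = 1 :> R.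
Proof.
pose c s : R := if (s <= r)%N then (-1) ^+ s * 'C(q + (r - s), r - s)%:R * 'C(q, s)%:R else 0.
rewrite -(sum_ord_widen _ q.+1 (q + r).+1 c) ?ltnS ?leq_addr //; last first.
  by move=> s qs; rewrite /c; case: ifP => // _; rewrite (bin_small qs) mulr0.
rewrite (sum_ord_widen _ r.+1 (q + r).+1 c) ?ltnS ?leq_addl //; last first.
  by move=> s rs; rewrite /c leqNgt rs.
have := zbinom_Vandermonde R q (Negz q) r.
have -> : q%:Z + Negz q = -1 by lia.
rewrite /= add0n binn mulr1 => E.
rewrite -[RHS](sqrr_sign R (odd r)) signr_odd expr2 {2}E mulr_sumr.
apply: eq_bigr => s _; have := ltn_ord s; rewrite ltnS => sr; rewrite /c sr.
rewrite mulrCA mulrC; congr (_ * _); rewrite mulrA; congr (_ * _).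
rewrite -exprD -[LHS]signr_odd -[RHS]signr_odd; congr (_ ^+ _).
by congr nat_of_bool; lia.
Qed.

(** * The pairing defined by a functional: symmetry, orthogonality of degrees, invariance *)

Section Pairing.
Variables (F : fieldType) (V : lmodType F).
Variables (Y : int -> V -> V -> V) (one : V) (Vg : int -> V -> Prop).
Variables (L1 Lm1 L0 : nat -> V -> V).
Hypothesis HV : H_module_VA Y one Vg L1 Lm1 L0.
Variable f : V -> F.
Hypothesis Hf : dual_quotient_elt Vg L1 f.

(** [N] is a truncation order: the value is the intended one when [L1 k u = 0]
    for all [k >= N]. *)
Definition pairing (d : int) (N : nat) (u v : V) : F :=
  intsign F d * \sum_(k < N) f (Y (2 * d - (k : nat)%:Z - 1) (L1 k u) v).

Let Y0l n v : Y n 0 v = 0.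
Proof. exact: (lin_0 (Y_linl HV n v)). Qed.

Let Y0r n v : Y n v 0 = 0.
Proof. exact: (lin_0 (Y_linr HV n v)). Qed.

Let f0 : f 0 = 0.
Proof. exact: (fun_0 Hf). Qed.
Let fZ a x : f (a *: x) = a * f x.
Proof. exact: (fun_Z Hf). Qed.
Let fB x y : f (x - y) = f x - f y.
Proof. exact: (fun_B Hf). Qed.

Lemma pairing_linr d N u : linear (pairing d N u : V -> F^o).
Proof.
move=> a x y; rewrite /pairing.
under eq_bigr => k _.
  rewrite (Y_linr HV) (fun_D Hf) fZ; over.
by rewrite big_split -mulr_sumr /= mulrDr mulrCA.
Qed.

Lemma pairing_linl d N v : linear (pairing d N ^~ v : V -> F^o).
Proof.
move=> a x y; rewrite /pairing.
under eq_bigr => k _.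
  rewrite (L1_lin HV) (Y_linl HV) (fun_D Hf) fZ; over.
by rewrite big_split -mulr_sumr /= mulrDr mulrCA.
Qed.

Lemma pairing_trunc d N M u v :
  (forall k, (N <= k)%N -> L1 k u = 0) -> (forall k, (M <= k)%N -> L1 k u = 0) ->
  pairing d N u v = pairing d M u v.
Proof.
move=> uN uM; rewrite /pairing; congr (_ * _).
pose h k := f (Y (2 * d - k%:Z - 1) (L1 k u) v).
have hN k : (N <= k)%N -> h k = 0 by move=> /uN E; rewrite /h E Y0l f0.
have hM k : (M <= k)%N -> h k = 0 by move=> /uM E; rewrite /h E Y0l f0.
by rewrite -(sum_ord_widen _ N (N + M) h) ?leq_addr // (sum_ord_widen _ M (N + M) h) ?leq_addl.
Qed.

Lemma pairing_sym d u v N M : Vg d u -> Vg d v ->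
  (forall k, (N <= k)%N -> L1 k u = 0) -> (forall k, (M <= k)%N -> L1 k v = 0) ->
  pairing d N u v = pairing d M v u.
Proof.
move=> du dv uN vM; rewrite /pairing; congr (_ * _).
have dv0 : Vg (d - 0%:Z) v by rewrite subr0.
have := pairing_swap HV Hf du dv0 uN vM; rewrite mul1r => <-.
by apply: eq_bigr => k _; rewrite subr0.
Qed.

Lemma pairing_degree d e u v N : d != e -> Vg d u -> Vg e v -> pairing d N u v = 0.
Proof.
move=> /eqP de du ev; rewrite /pairing big1 ?mulr0 // => k _.
apply: (fun_degree Hf); last first.
  exact: (homog_Y HV _ (homog_L1 HV _ du) ev).
by lia.
Qed.

(** Gives the adjunction of [Lm1 r] and [L1 r]: the left side is what invariance yields for
    [Y (- r - 1) w one]. On the right [fun_cond_iii] moves [L1 r] next to [L1 k]; collecting the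
    terms with [L1 q w], their coefficients add up to 1 by [sum_bin_sign_bin]. *)
Lemma pairing_Lm1 d w w' r N : Vg d w -> (forall k, (N <= k)%N -> L1 k w = 0) ->
  \sum_(q < N) f (Y (2 * d - (q : nat)%:Z + r%:Z - 1) (L1 q w) w') =
  \sum_(k < N) f (Y (2 * d - (k : nat)%:Z - 1) (L1 k w) (L1 r w')).
Proof.
move=> dw wN.
pose G q := f (Y (2 * d - q%:Z + r%:Z - 1) (L1 q w) w').
have G0 q : (N <= q)%N -> G q = 0 by move=> /wN E; rewrite /G E Y0l f0.
pose g s k := (if (s <= r)%N
  then (-1) ^+ s * 'C(s + k + (r - s), r - s)%:R * 'C(s + k, s)%:R else 0) * G (s + k)%N.
transitivity (\sum_(q < r.+1 + N) \sum_(s < q.+1) g s (q - s)%N).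
  rewrite -(sum_ord_widen _ N (r.+1 + N) G) ?leq_addl //; apply: eq_bigr => q _.
  rewrite -[LHS]mul1r -(sum_bin_sign_bin F q r) mulr_suml; apply: eq_bigr => s _.
  by rewrite /g subnKC // -ltnS.
rewrite (sum_triangle _ _ r.+1 N g) //; last first.
  move=> s k /orP[rs|Nk]; rewrite /g; first by rewrite leqNgt rs mul0r.
  by rewrite G0 ?mulr0 // (leq_trans Nk) // leq_addl.
apply: eq_bigr => k _.
rewrite -[RHS]mul1r -(sqrr_sign F (odd r)) signr_odd expr2 -mulrA.
rewrite (fun_cond_iii HV Hf _ _ _ (homog_L1 HV k dw)).
rewrite (reindex_inj rev_ord_inj) mulr_sumr /=; apply: eq_bigr => j _.
have := ltn_ord j; rewrite ltnS => jr; rewrite /g subSS leq_subr.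
have -> : r%:Z - 2 * (d - k%:Z) + (2 * d - k%:Z - 1) + 1 = (r + k)%N%:Z by lia.
rewrite (L1_L1 HV) (lin_Z (Y_linl HV _ _)) fZ /= subKn //.
have -> : (r - j + k + j = r + k)%N by lia.
rewrite /G [2 * d - _ + _ - 1](_ : _ = 2 * d - k%:Z - 1 + j%:Z); last by lia.
have -> : 'C(r - j + k, k) = 'C(r - j + k, r - j) by rewrite -bin_sub ?leq_addl // addnK.
rewrite !mulrA; congr (_ * _).
congr (_ * _); congr (_ * _).
rewrite -exprD -[LHS]signr_odd -[RHS]signr_odd; congr (_ ^+ _).
by congr nat_of_bool; lia.
Qed.

(** [L1_Y] expands the left side into left sides of Jacobi identities for the pairs [L1 k v],
    [L1 l w]. Once summed over [k] and [l], the right sides vanish by [pairing_neg_degree] except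
    for one term. *)
Lemma pairing_invariant d e v w w' n K L R : Vg d v -> Vg e w ->
  (forall k, (K <= k)%N -> L1 k v = 0) -> (forall k, (L <= k)%N -> L1 k w = 0) ->
  (forall k, (R <= k)%N -> L1 k (Y n v w) = 0) ->
  pairing (d + e - n - 1) R (Y n v w) w' =
  intsign F d * \sum_(k < K) pairing e L w (Y (2 * d - (k : nat)%:Z - n - 2) (L1 k v) w').
Proof.
move=> dv ew vK wL vwR; set D := d + e - n - 1.
(* These exponents make the outer modes on the right of the Jacobi identity [2d - k - 1 - (i+1)] and
   [2e - l - 1 - i]: the shift is always positive in the first family and zero only at [i = 0] in
   the second. *)
pose m k : int := 2 * d - k%:Z - n - 2.
pose n' l : int := 2 * e - l%:Z - n - 1.
have [J JP] : exists J, forall k j, (k < K)%N -> (J <= j)%N -> forall l, (l < L)%N ->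
    [/\ Y (n + j%:Z) (L1 k v) (L1 l w) = 0, Y (n' l + j%:Z) (L1 l w) w' = 0 &
        Y (m k + j%:Z) (L1 k v) w' = 0].
  apply: uniform_bound => k.
  have [J JP] : exists J, forall l j, (l < L)%N -> (J <= j)%N ->
    [/\ Y (n + j%:Z) (L1 k v) (L1 l w) = 0, Y (n' l + j%:Z) (L1 l w) w' = 0 &
        Y (m k + j%:Z) (L1 k v) w' = 0].
    apply: uniform_bound => l.
    have [N1 N1P] := Y_trunc HV (L1 k v) (L1 l w).
    have [N2 N2P] := Y_trunc HV (L1 l w) w'.
    have [N3 N3P] := Y_trunc HV (L1 k v) w'.
    exists (`|N1 - n| + `|N2 - n' l| + `|N3 - m k|)%N => j Jj.
    by split; [apply: N1P | apply: N2P | apply: N3P]; lia.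
  by exists J => j Jj l lL; exact: JP.
pose h j k l := zbinom F (m k) j *
  f (Y (m k + n' l - j%:Z) (Y (n + j%:Z) (L1 k v) (L1 l w)) w').
have h0 j k l : [|| (J <= j)%N, (K <= k)%N | (L <= l)%N] -> h j k l = 0.
  rewrite /h; case: (leqP K k) => [/vK->|kK]; first by rewrite !Y0l f0 mulr0.
  case: (leqP L l) => [/wL->|lL]; first by rewrite Y0r Y0l f0 mulr0.
  rewrite !orbF => Jj; have [-> _ _] := JP k j kK Jj l lL.
  by rewrite Y0l f0 mulr0.
(* The bound [J.+1] guarantees that the index [i = 0], which carries the surviving term, is
   present. *)
have hJ k l : (k < K)%N -> (l < L)%N -> \sum_(j < J.+1) h j k l =
    \sum_(i < J.+1) (-1) ^+ i * zbinom F n i *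
      (f (Y (2 * d - k%:Z - 1 - i.+1%:Z) (L1 k v) (Y (n' l + (i : nat)%:Z) (L1 l w) w')) -
       intsign F n * f (Y (2 * e - l%:Z - 1 - (i : nat)%:Z) (L1 l w)
         (Y (m k + (i : nat)%:Z) (L1 k v) w'))).
  move=> kK lL.
  have tr j : (J.+1 <= j)%N -> [/\ Y (n + j%:Z) (L1 k v) (L1 l w) = 0,
      Y (n' l + j%:Z) (L1 l w) w' = 0 & Y (m k + j%:Z) (L1 k v) w' = 0].
    by move=> Jj; apply: JP => //; exact: ltnW.
  have /(congr1 f) := Y_jacobi HV tr.
  rewrite !(fun_sum Hf) => E.
  transitivity (\sum_(i < J.+1) f (zbinom F (m k) i *:
       Y (m k + n' l - (i : nat)%:Z) (Y (n + (i : nat)%:Z) (L1 k v) (L1 l w)) w')).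
    by apply: eq_bigr => j _; rewrite fZ.
  rewrite E; apply: eq_bigr => i _; rewrite fZ fB fZ.
  congr (_ * (f (Y _ _ _) - _ * f (Y _ _ _))); rewrite /m /n'; lia.
transitivity (intsign F D * \sum_(l < L) \sum_(k < K) \sum_(j < J.+1) h j k l).
  pose M := (J.+1 + K + L + R)%N.
  have vwM k : (M <= k)%N -> L1 k (Y n v w) = 0 by move=> Mk; apply: vwR; lia.
  rewrite (pairing_trunc _ _ vwR vwM) /pairing; congr (_ * _).
  (* The order [r] of [L1] is distributed as [r = s + l] with [s = j + k]. *)
  pose A s l := \sum_(j < s.+1) h j (s - j)%N l.
  transitivity (\sum_(r < M) \sum_(s < r.+1) A s (r - s)%N).
    apply: eq_bigr => r _; rewrite (L1_Y HV _ _ _ dv).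
    rewrite (lin_sum (Y_linl HV _ _)) (fun_sum Hf).
    apply: eq_bigr => s _; rewrite (lin_sum (Y_linl HV _ _)) (fun_sum Hf).
    apply: eq_bigr => j _; rewrite (lin_Z (Y_linl HV _ _)) fZ.
    rewrite zbinom_upper_negation /h.
    have := ltn_ord s; have := ltn_ord j; rewrite !ltnS => js sr.
    congr (zbinom F _ _ * f (Y _ _ _)); rewrite /m /n' /D; lia.
  rewrite (sum_triangle _ M (J.+1 + K) L A) //; last first.
  - move=> s l /orP[Js|Ll]; rewrite /A big1 // => j _; apply: h0; last by rewrite Ll !orbT.
    have := ltn_ord j; lia.
  - by rewrite /M leq_addr.
  apply: eq_bigr => l _; rewrite (sum_triangle _ _ J.+1 K (fun j k => h j k l)) //.
  by move=> j k jk; apply: h0; lia.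
pose c i := (-1) ^+ i * zbinom F n i.
pose S1 i := \sum_(l < L) \sum_(k < K)
  f (Y (2 * d - (k : nat)%:Z - 1 - i.+1%:Z) (L1 k v) (Y (n' l + i%:Z) (L1 l w) w')).
pose S2 i := \sum_(k < K) \sum_(l < L)
  f (Y (2 * e - (l : nat)%:Z - 1 - i%:Z) (L1 l w) (Y (m k + i%:Z) (L1 k v) w')).
have S10 i : S1 i = 0.
  by apply: big1 => l _; exact: (pairing_neg_degree HV Hf).
have S20 i : (0 < i)%N -> S2 i = 0.
  by move=> i0; apply: big1 => k _; exact: (pairing_neg_degree HV Hf).
transitivity (intsign F D * \sum_(i < J.+1) c i * (S1 i - intsign F n * S2 i)).
  congr (_ * _).
  transitivity (\sum_(l < L) \sum_(k < K) \sum_(i < J.+1) c i *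
      (f (Y (2 * d - (k : nat)%:Z - 1 - i.+1%:Z) (L1 k v) (Y (n' l + (i : nat)%:Z) (L1 l w) w')) -
       intsign F n * f (Y (2 * e - (l : nat)%:Z - 1 - (i : nat)%:Z) (L1 l w)
         (Y (m k + (i : nat)%:Z) (L1 k v) w')))).
    by apply: eq_bigr => l _; apply: eq_bigr => k _; exact: hJ.
  under eq_bigr => l _ do rewrite exchange_big.
  rewrite exchange_big /=; apply: eq_bigr => i _.
  have -> : S2 i = \sum_(l < L) \sum_(k < K)
      f (Y (2 * e - (l : nat)%:Z - 1 - (i : nat)%:Z) (L1 l w)
         (Y (m k + (i : nat)%:Z) (L1 k v) w')).
    by rewrite /S2 exchange_big.
  rewrite /S1 mulr_sumr -sumrB mulr_sumr; apply: eq_bigr => l _.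
  by rewrite mulr_sumr -sumrB mulr_sumr.
rewrite big_ord_recl big1 => [|i _]; last by rewrite S10 S20 // mulr0 subrr mulr0.
rewrite S10 sub0r addr0 /c zbinom0 mulr1 expr0 mul1r mulrN mulrA -mulNr.
rewrite /S2 [in RHS]/pairing -mulr_sumr mulrA; congr (_ * _).
  (* Signs: [(-1)^(d+e-n-1)] times [-(-1)^n] is [(-1)^d (-1)^e]. *)
  rewrite /D; have -> : d + e - n - 1 = d + e + (- n + - 1) by lia.
  by rewrite !intsignD !intsignN {4}/intsign /= mulrN1 mulrN mulNr opprK -!mulrA intsign_sqr mulr1.
apply: eq_bigr => k _; apply: eq_bigr => l _; rewrite /m -[nat_of_ord ord0]/0%N.
congr (f (Y _ _ (Y _ _ _))); lia.
Qed.

End Pairing.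

(** * Gluing bilinear maps given degree by degree *)

Lemma big_mem_uniq (T : eqType) (W : nmodType) (s r : seq T) (G : T -> W) :
  uniq s -> uniq r -> {subset s <= r} ->
  \sum_(d <- r) (if d \in s then G d else 0) = \sum_(d <- s) G d.
Proof.
move=> us ur sr; rewrite -big_mkcond -big_filter; apply: perm_big.
apply: uniq_perm => //; first exact: filter_uniq.
by move=> d; rewrite mem_filter; case ds: (d \in s); rewrite //= (sr _ ds).
Qed.

(** A decomposition of each [u] is chosen and [b d] is applied to its component of degree [d].
    Additivity in [u] holds because directness of the grading makes the components independent of
    the choice. *)
Lemma graded_extension (F : fieldType) (V : lmodType F) (Vg : int -> V -> Prop)
    (b : int -> V -> V -> F) :
  is_grading Vg ->
  (forall d v, linear (b d ^~ v : V -> F^o)) -> (forall d u, linear (b d u : V -> F^o)) ->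
  exists B : V -> V -> F, bilinear_form B /\
    forall d u v, Vg d u -> B u v = b d u v.
Proof.
move=> [Vg0 VgP Vdec Vdir] b_linl b_linr.
have bZ0 d v : b d 0 v = 0 by exact: (lin_0 (b_linl d v)).
pose is_dec v (x : seq int * (int -> V)) :=
  [/\ uniq x.1, forall n, Vg n (x.2 n) & v = \sum_(n <- x.1) x.2 n].
have decP v : exists x, is_dec v x by have [s [g H]] := Vdec v; exists (s, g).
pose dec v := proj1_sig (constructive_indefinite_description _ (decP v)).
have decE v : is_dec v (dec v) by rewrite /dec; case: constructive_indefinite_description.
pose B u v := \sum_(d <- (dec u).1) b d ((dec u).2 d) v.
(* Components padded by zero, so that vectors with different decompositions can be compared over a
   common list of degrees. *)
pose pr u d := if d \in (dec u).1 then (dec u).2 d else 0.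
have prg u d : Vg d (pr u d) by rewrite /pr; case: ifP => _ //; case: (decE u).
have prE u r : uniq r -> {subset (dec u).1 <= r} -> u = \sum_(d <- r) pr u d.
  by move=> ur sr; have [us _ uE] := decE u; rewrite {1}uE (big_mem_uniq _ us ur sr).
have BE u r v : uniq r -> {subset (dec u).1 <= r} -> B u v = \sum_(d <- r) b d (pr u d) v.
  move=> ur sr; have [us _ _] := decE u; rewrite /B -(big_mem_uniq _ us ur sr).
  by apply: eq_bigr => d _; rewrite /pr; case: ifP => // _; rewrite bZ0.
have prD a u u' r : uniq r -> {subset (dec u).1 <= r} -> {subset (dec u').1 <= r} ->
    {subset (dec (a *: u + u')).1 <= r} ->
    forall d, d \in r -> pr (a *: u + u') d = a *: pr u d + pr u' d.
  move=> ur s1 s2 s3 d dr; apply/eqP; rewrite -subr_eq0 -opprB oppr_eq0; apply/eqP.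
  pose g n := a *: pr u n + pr u' n - pr (a *: u + u') n.
  apply: (Vdir r g) => // [n|].
    by rewrite /g addrC -scaleN1r; apply: (VgP); [|apply: VgP].
  rewrite /g sumrB big_split /= -scaler_sumr -!prE //; exact: subrr.
have prh d u e : Vg d u -> (e \in d :: (dec u).1) -> pr u e = if e == d then u else 0.
  move=> du; pose r := undup (d :: (dec u).1) => er.
  have ur : uniq r := undup_uniq _.
  have sr : {subset (dec u).1 <= r} by move=> x xs; rewrite mem_undup inE xs orbT.
  apply/eqP; rewrite -subr_eq0; apply/eqP.
  pose g n := pr u n - (if n == d then u else 0).
  apply: (Vdir r g) => // [n| |]; last by rewrite mem_undup.
    rewrite /g addrC -scaleN1r; apply: VgP; last exact: prg.
    by case: eqP => [->|].
  rewrite /g sumrB -prE // -big_mkcond -big_filter filter_pred1_uniq ?big_seq1 ?subrr //.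
  by rewrite mem_undup mem_head.
exists B; split; first split.
- move=> a x y z; pose r := undup ((dec x).1 ++ (dec y).1 ++ (dec (a *: x + y)).1).
  have ur : uniq r := undup_uniq _.
  have s1 : {subset (dec x).1 <= r} by move=> d; rewrite mem_undup !mem_cat => ->.
  have s2 : {subset (dec y).1 <= r} by move=> d; rewrite mem_undup !mem_cat => ->; rewrite orbT.
  have s3 : {subset (dec (a *: x + y)).1 <= r}.
    by move=> d; rewrite mem_undup !mem_cat => ->; rewrite !orbT.
  rewrite (BE _ _ _ ur s1) (BE _ _ _ ur s2) (BE _ _ _ ur s3) mulr_sumr -big_split.
  rewrite !big_seq; apply: eq_bigr => d dr.
  by rewrite (prD _ _ _ _ ur s1 s2 s3) // b_linl.
- move=> a x y z; rewrite /B mulr_sumr -big_split.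
  by apply: eq_bigr => d _; rewrite b_linr.
move=> d u v du; pose r := undup (d :: (dec u).1).
have sr : {subset (dec u).1 <= r} by move=> x xs; rewrite mem_undup inE xs orbT.
rewrite (BE _ _ _ (undup_uniq _) sr) big_seq.
rewrite (eq_bigr (fun e => if e == d then b d u v else 0)) => [|e]; last first.
  rewrite mem_undup => /(prh _ _ _ du) ->; case: eqP => [->//|_]; exact: bZ0.
rewrite -big_seq -big_mkcond -big_filter filter_pred1_uniq ?big_seq1 ?undup_uniq //.
by rewrite mem_undup mem_head.
Qed.

(** * Correspondence between invariant forms and functionals *)

Section InvariantForms.
Variables (F : fieldType) (V : lmodType F).
Variables (Y : int -> V -> V -> V) (one : V) (Vg : int -> V -> Prop).
Variables (L1 Lm1 L0 : nat -> V -> V).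
Hypothesis HV : H_module_VA Y one Vg L1 Lm1 L0.

Lemma bilinear_homog_ext (B B' : V -> V -> F) :
  bilinear_form B -> bilinear_form B' ->
  (forall d e u v, Vg d u -> Vg e v -> B u v = B' u v) -> forall u v, B u v = B' u v.
Proof.
move=> [Bl Br] [Bl' Br'] H u v; move: u; apply: (homog_ind HV).
  by move=> a x y Ex Ey; rewrite Bl Bl' Ex Ey.
move=> d u du; move: v; apply: (homog_ind HV).
  by move=> a x y Ex Ey; rewrite Br Br' Ex Ey.
by move=> e v ev; exact: H du ev.
Qed.

Lemma bilinear_form_swap (B : V -> V -> F) : bilinear_form B -> bilinear_form (fun u v => B v u).
Proof. by case. Qed.

(** Assumes only bilinearity and the pairing formula, so as to apply also to the form built from [f]
    before its invariance is established. *)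
Lemma bilinear_sym_of_pairing (f : V -> F) (B : V -> V -> F) :
  dual_quotient_elt Vg L1 f -> bilinear_form B ->
  (forall d u v N, Vg d u -> (forall k, (N <= k)%N -> L1 k u = 0) ->
     B u v = pairing Y L1 f d N u v) ->
  forall u v, B u v = B v u.
Proof.
move=> Hf bB BE; apply: bilinear_homog_ext => //; first exact: bilinear_form_swap.
move=> d e u v du ev.
have [N /(_ u du) uN] := homog_L1_trunc HV d.
have [M /(_ v ev) vM] := homog_L1_trunc HV e.
rewrite (BE d u v N) // (BE e v u M) //.
have [de|de] := eqVneq d e.
  by subst e; exact: (pairing_sym HV Hf).
rewrite (pairing_degree HV Hf _ de du ev).
by rewrite eq_sym in de; rewrite (pairing_degree HV Hf _ de ev du).
Qed.

Section FormToFunctional.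
Variable B : V -> V -> F.
Hypothesis HB : invariant_form Y Vg L1 Lm1 L0 B.

Lemma form_linr u : linear (B u : V -> F^o).
Proof. by case: HB => -[_ +] _ _ a x y; apply. Qed.

Lemma form_linl v : linear (B^~ v : V -> F^o).
Proof. by case: HB => -[+ _] _ _ a x y; apply. Qed.

Lemma form_0l v : B 0 v = 0.
Proof. exact: (lin_0 (form_linl v)). Qed.

(** Both vanishing properties come from adjunction against [one]: [L0 r one = 0] for [r > 0], while
    some such [L0 r] acts on a nonzero degree by a nonzero scalar; and [Lm1 n one = 0] for
    [n > 0]. *)
Lemma form_one_dual : dual_quotient_elt Vg L1 (B one).
Proof.
case: HB => -[Bl Br] _ BH.
have B0r x : B x 0 = 0 by exact: (lin_0 (form_linr x)).
split=> [a x y|n x n0 nx|x _ [N [y ->]]]; first exact: Br.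
  have n20 : - 2 * n != 0 by lia.
  have [r r0 rn] := zbinom_nontrivial F (oner_neq0 F) _ n20.
  have [_ _] := BH r one x.
  rewrite (L0_homog HV _ nx) (lin_Z (form_linr one)).
  rewrite (L0_homog HV _ (homog_one HV)) mulr0 /= bin0n.
  rewrite (gtn_eqF r0) scale0r form_0l => /esym/eqP.
  by rewrite mulf_eq0 (negbTE rn) => /eqP.
rewrite (lin_sum (form_linr one)) big_nat_cond big1 // => n /andP[/andP[n0 _] _].
have [_ <- _] := BH n one (y n).
rewrite (Lm1_Y HV) (Y_vacuum HV) ifF ?form_0l //.
by apply/eqP; lia.
Qed.

Lemma form_pairing d u v N : Vg d u -> (forall k, (N <= k)%N -> L1 k u = 0) ->
  B u v = pairing Y L1 (B one) d N u v.
Proof.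
move=> du uN; case: HB => _ BY _.
have E : u = Y (-1) u one by rewrite -(Lm1_Y HV 0) (Lm1_0 HV).
rewrite {1}E (BY _ _ _ _ _ N du uN) /pairing; congr (_ * _).
by apply: eq_bigr => k _; congr (B _ (Y _ _ _)); lia.
Qed.

End FormToFunctional.

Lemma invariant_form_sym B : invariant_form Y Vg L1 Lm1 L0 B -> forall u v, B u v = B v u.
Proof.
move=> HB; apply: (bilinear_sym_of_pairing (form_one_dual HB)); first by case: HB.
by move=> *; exact: form_pairing.
Qed.

Lemma invariant_form_unique B B' :
  invariant_form Y Vg L1 Lm1 L0 B -> invariant_form Y Vg L1 Lm1 L0 B' ->
  (forall v, B one v = B' one v) -> forall u v, B u v = B' u v.
Proof.
move=> HB HB' E; apply: bilinear_homog_ext; [by case: HB | by case: HB' |].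
move=> d e u v du _; have [N /(_ u du) uN] := homog_L1_trunc HV d.
rewrite (form_pairing HB _ du uN) (form_pairing HB' _ du uN).
by congr (_ * _); apply: eq_bigr => k _.
Qed.

(** The pairings of all degrees are glued into [B]. Symmetry and the invariance of [Y] come first;
    the adjunctions for [H] are deduced from them. *)
Lemma invariant_form_of_dual f : dual_quotient_elt Vg L1 f ->
  exists2 B, invariant_form Y Vg L1 Lm1 L0 B & forall v, B one v = f v.
Proof.
move=> Hf; have [n0 n0P] := degree_bound HV.
pose N d := `|d - n0|%N.+1.
have NP d u : Vg d u -> forall k, (N d <= k)%N -> L1 k u = 0.
  move=> du k Nk; apply: (n0P (d - k%:Z)); first by rewrite /N in Nk; lia.
  exact: (homog_L1 HV).
have [B [bB BE']] := @graded_extension F V Vg (fun d => pairing Y L1 f d (N d))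
  (grading_axioms HV)
  (fun d => pairing_linl HV Hf d (N d))
  (fun d => pairing_linr HV Hf d (N d)).
have BE d u v M : Vg d u -> (forall k, (M <= k)%N -> L1 k u = 0) ->
    B u v = pairing Y L1 f d M u v.
  move=> du uM; rewrite (BE' _ _ _ du).
  exact: (pairing_trunc HV Hf _ _ (NP _ _ du) uM).
have Bsym := bilinear_sym_of_pairing Hf bB BE.
have [Bl Br] := bB.
have Bone v : B one v = f v.
  rewrite (BE 0 one v 1%N) => [||k k0].
  - rewrite /pairing big_ord1 mul1r (L1_0 HV) (Y_vacuum HV).
    by [].
  - exact: (homog_one HV).
  - by rewrite (L1_one HV) gtn_eqF.
have BYinv : invariant_Y Y Vg L1 B.
  move=> d v w w' n M dv vM; move: w; apply: (homog_ind HV).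
    move=> a x y Ex Ey; rewrite (Y_linr HV) Bl Ex Ey.
    rewrite mulrCA -mulrDr mulr_sumr -big_split; congr (_ * _).
    by apply: eq_bigr => k _; rewrite Bl.
  move=> e w ew; pose D := d + e - n - 1.
  have Dvw : Vg D (Y n v w) by exact: (homog_Y HV).
  rewrite (BE D _ _ (N D) Dvw (NP _ _ Dvw)).
  rewrite (pairing_invariant HV Hf _ dv ew vM (NP _ _ ew) (NP _ _ Dvw)).
  by congr (_ * _); apply: eq_bigr => k _; rewrite (BE e w _ (N e) ew (NP _ _ ew)).
(* [Lm1 r w] is the mode [Y (- r - 1) w one], so this is an instance of the invariance of [Y]. *)
have BLm1 r w w' : B (Lm1 r w) w' = B w (L1 r w').
  move: w; apply: (homog_ind HV) => [a x y Ex Ey|d w dw].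
    by rewrite (Lm1_lin HV) !Bl Ex Ey.
  rewrite (Lm1_Y HV) (BYinv d w one w' _ (N d) dw (NP _ _ dw)).
  rewrite (BE d w _ (N d) dw (NP _ _ dw)) /pairing; congr (_ * _).
  rewrite -(pairing_Lm1 HV Hf _ _ dw (NP _ _ dw)).
  by apply: eq_bigr => k _; rewrite Bone; congr (f (Y _ _ _)); lia.
exists B => //; split=> // r w w'; split=> //.
  by rewrite Bsym -BLm1 Bsym.
apply: (@bilinear_homog_ext (fun w w' => B (L0 r w) w') (fun w w' => B w (L0 r w'))).
- by split=> a x y z; rewrite ?(L0_lin HV) ?Bl ?Br.
- by split=> a x y z; rewrite ?(L0_lin HV) ?Bl ?Br.
move=> d e u v du ev.
rewrite (L0_homog HV _ du) (L0_homog HV _ ev).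
rewrite (lin_Z (f := B^~ v : V -> F^o) (fun a x y => Bl a x y v)).
rewrite (lin_Z (f := B u : V -> F^o) (fun a => Br a u)).
(* In equal degrees [L0 r] acts on both sides by the same scalar; distinct degrees are
   orthogonal. *)
have [->//|de] := eqVneq d e.
rewrite (BE d u v (N d) du (NP _ _ du)) (pairing_degree HV Hf _ de du ev).
by rewrite [_ *: _]mulr0 [_ *: _]mulr0.
Qed.

End InvariantForms.

Unset Implicit Arguments.

Theorem theorem4p10 (F : closedFieldType) (p : nat) (hp : prime p) (hodd : odd p)
    (hchar : p \in [pchar F]) (V : lmodType F)
    (Y : int -> V -> V -> V) (one : V) (Vg : int -> V -> Prop)
    (L1 Lm1 L0 : nat -> V -> V)
    (HV : H_module_VA Y one Vg L1 Lm1 L0) :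
  (forall B : V -> V -> F, invariant_form Y Vg L1 Lm1 L0 B ->
     forall x y, B x y = B y x) /\
  exists Phi : (V -> V -> F) -> (V -> F),
    [/\ (forall B, invariant_form Y Vg L1 Lm1 L0 B ->
           dual_quotient_elt Vg L1 (Phi B)),
        (forall (a : F) B B', invariant_form Y Vg L1 Lm1 L0 B ->
           invariant_form Y Vg L1 Lm1 L0 B' ->
           forall x, Phi (fun u v => a * B u v + B' u v) x = a * Phi B x + Phi B' x),
        (forall B B', invariant_form Y Vg L1 Lm1 L0 B ->
           invariant_form Y Vg L1 Lm1 L0 B' ->
           (forall x, Phi B x = Phi B' x) -> forall x y, B x y = B' x y) &
        (forall f, dual_quotient_elt Vg L1 f ->
           exists B, invariant_form Y Vg L1 Lm1 L0 B /\ forall x, Phi B x = f x)].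
Proof.
split; first by move=> B HB; exact: (invariant_form_sym HV HB).
(* The isomorphism restricts the first argument of the form to the vacuum, which determines the form
   because [u = Y (-1) u one]. *)
exists (fun B => B one); split=> //.
- by move=> B HB; exact: (form_one_dual HV HB).
- by move=> B B'; exact: (invariant_form_unique HV).
move=> f Hf; have [B HB BE] := invariant_form_of_dual HV Hf.
by exists B.
Qed.
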